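(* Let $R$ be a left artinian ring and consider a short exact sequence $0\to U_1\xrightarrow{f}M\xrightarrow{g}U_2\to0$ of finitely generated left $R$-modules with $U_1$ and $U_2$ uniserial. Then $M$ is either indecomposable or a direct sum of two uniserial modules.
   Context: A module is uniserial if it has only one composition series with simple factors. *)

(* Defs.v *)
From HB Require Import structures.
From mathcomp Require Import all_boot all_order all_algebra.
From mathcomp Require Import boolp classical_sets.

Set Implicit Arguments.
Unset Strict Implicit.
Unset Printing Implicit Defensive.

Import GRing.Theory.
Local Open Scope ring_scope.
Local Open Scope quotient_scope.

(* Submodules are the library's [submodClosed M], whose carriers are boolean
   predicates.  The two lemmas below check that, with the classical axioms of
   boolp, every submodule is of this form and that equality is extensional. *)
Section Submodules.
Variables (R : pzRingType) (M : lmodType R).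
Implicit Types A B : submodClosed M.

Lemma submodClosed_of_set (S : set M) :
    S 0 -> (forall (a : R) x y, S x -> S y -> S (a *: x + y)) ->
  exists A : submodClosed M, forall x, x \in A <-> S x.
Proof.
move=> S0 SL.
have cl : submod_closed [pred x | `[< S x >]].
  split; first exact/asboolP.
  by move=> a x y /asboolP Sx /asboolP Sy; apply/asboolP/SL.
pose clP := GRing.isSubmodClosed.Build R M (fun x => `[< S x >]) cl.
pose A : submodClosed M := HB.pack (fun x : M => `[< S x >]) clP.
by exists A => x; split => [/asboolP|Sx] //; apply/asboolP.
Qed.

Lemma submodClosed_ext A B : A =i B -> A = B.
Proof.
case: A B => [a ca] [b cb] eqAB.
have eab : a = b by apply/funext => x; apply: eqAB.
subst b; congr GRing.SubmodClosed.Pack.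
case: ca cb {eqAB} => [[a0] [aZ]] [[b0] [bZ]].
by rewrite (Prop_irrelevance a0 b0) (Prop_irrelevance aZ bZ).
Qed.

End Submodules.

Section SubmodType.
Variables (R : pzRingType) (M : lmodType R) (A : submodClosed M).

Record submod_type : Type :=
  SubmodElt { submod_val :> M; _ : submod_val \in A }.

HB.instance Definition _ := [isSub for submod_val].
HB.instance Definition _ := [Choice of submod_type by <:].

HB.instance Definition _ := [SubChoice_isSubLmodule of submod_type by <:].

End SubmodType.

Section QuotMod.
Variables (R : pzRingType) (M : lmodType R) (A : submodClosed M).

Definition submod_zmod : zmodClosed M :=
  HB.pack (A : {pred M}) (GRing.isZmodClosed.Build M (A : {pred M})
    (GRing.submod_closedB (submodClosedP A))).

Definition quotmod : Type := Quotient.quot submod_zmod.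

HB.instance Definition _ := ZmodQuotient.on quotmod.

Definition quotmod_proj (x : M) : quotmod := \pi_quotmod x.

Lemma quotmod_projE x y : (quotmod_proj x == quotmod_proj y) = (x - y \in A).
Proof. by rewrite /quotmod_proj piE. Qed.

Fact quotmod_proj_is_zmod_morphism : zmod_morphism quotmod_proj.
Proof. by move=> x y; rewrite /quotmod_proj !piE. Qed.

HB.instance Definition _ :=
  GRing.isZmodMorphism.Build M quotmod quotmod_proj quotmod_proj_is_zmod_morphism.

Definition quotmod_scale (a : R) (q : quotmod) : quotmod :=
  quotmod_proj (a *: repr q).

Lemma quotmod_reprK : cancel repr quotmod_proj.
Proof. exact: reprK. Qed.

Lemma quotmod_scaleE a x : quotmod_scale a (quotmod_proj x) = quotmod_proj (a *: x).
Proof.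
apply/eqP; rewrite quotmod_projE -scalerBr rpredZ //.
by rewrite -quotmod_projE quotmod_reprK.
Qed.

Fact quotmod_scalerA a b q :
  quotmod_scale a (quotmod_scale b q) = quotmod_scale (a * b) q.
Proof. by rewrite -[q]quotmod_reprK !quotmod_scaleE scalerA. Qed.

Fact quotmod_scale1r : left_id 1 quotmod_scale.
Proof. by move=> q; rewrite -[q]quotmod_reprK quotmod_scaleE scale1r. Qed.

Fact quotmod_scalerDr : right_distributive quotmod_scale +%R.
Proof.
move=> a p q; rewrite -[p]quotmod_reprK -[q]quotmod_reprK -raddfD.
by rewrite !quotmod_scaleE scalerDr raddfD.
Qed.

Fact quotmod_scalerDl q : {morph quotmod_scale^~ q : a b / a + b}.
Proof.
by move=> a b; rewrite -[q]quotmod_reprK !quotmod_scaleE scalerDl raddfD.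
Qed.

HB.instance Definition _ := GRing.Zmodule_isLmodule.Build R quotmod
  quotmod_scalerA quotmod_scale1r quotmod_scalerDr quotmod_scalerDl.

Fact quotmod_proj_is_scalable : scalable quotmod_proj.
Proof. by move=> a x; rewrite -quotmod_scaleE. Qed.

HB.instance Definition _ :=
  GRing.isScalable.Build R M quotmod *:%R quotmod_proj quotmod_proj_is_scalable.

End QuotMod.

(* The factor B / A: the trace of A on B, as a submodule of B, and the
   quotient of B by it. *)
Section Factor.
Variables (R : pzRingType) (M : lmodType R) (A B : submodClosed M).

Definition submod_trace_pred : {pred submod_type B} :=
  [pred x | val x \in A].

Fact submod_trace_closed : submod_closed submod_trace_pred.
Proof.
split; first by rewrite inE raddf0 rpred0.
move=> a x y; rewrite !inE => Ax Ay.
by rewrite linearP rpredD ?rpredZ.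
Qed.

HB.instance Definition _ := GRing.isSubmodClosed.Build R (submod_type B)
  submod_trace_pred submod_trace_closed.

Definition factor : lmodType R := quotmod submod_trace_pred.

End Factor.

Section Modules.
Variables (R : pzRingType).
Implicit Types M N V W : lmodType R.

Definition zero_module M : Prop := forall x : M, x = 0.

Definition finitely_generated M : Prop :=
  exists (n : nat) (x : 'I_n -> M),
    forall m : M, exists c : 'I_n -> R, m = \sum_(i < n) c i *: x i.

Definition artinian M : Prop :=
  forall I : nat -> submodClosed M,
    (forall n, {subset I n.+1 <= I n}) ->
  exists n, forall m, (n <= m)%N -> I m =i I n.

Definition simple_module M : Prop :=
  ~ zero_module M /\
  forall A : submodClosed M, A =i pred1 0 \/ A =i predT.

Fixpoint simple_factors M (A : submodClosed M) (s : seq (submodClosed M)) :=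
  if s is B :: s' then
    [/\ {subset A <= B}, simple_module (factor A B) & simple_factors B s']
  else True.

(* The list s = [:: A_0; ...; A_n] enumerates 0 = A_0 < ... < A_n = M. *)
Definition composition_series M (s : seq (submodClosed M)) : Prop :=
  if s is A :: s' then
    [/\ A =i pred1 0, simple_factors A s' & last A s' =i predT]
  else False.

(* The zero module is uniserial: its only composition series is [:: 0]. *)
Definition uniserial M : Prop :=
  exists! s : seq (submodClosed M), composition_series s.

Definition short_exact U M V (f : {linear U -> M}) (g : {linear M -> V}) : Prop :=
  [/\ injective f,
      forall m : M, g m = 0 <-> exists u : U, f u = m
    & forall v : V, exists m : M, g m = v].

Definition is_direct_sum M V W : Prop :=
  exists h : {linear (V * W)%type -> M}, bijective h.

Definition indecomposable M : Prop :=
  ~ zero_module M /\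
  forall V W, is_direct_sum M V W -> zero_module V \/ zero_module W.

End Modules.

(* The submodules of R^o are the left ideals of R. *)
Definition left_artinian (R : pzRingType) : Prop := artinian R^o.

(* Main.v *)
Require Import Defs.
From HB Require Import structures.
From mathcomp Require Import all_boot all_order all_algebra.
From mathcomp Require boolp.
From Stdlib Require List.

(** The key is to recognize a uniserial module by its elements: a module [N] is
    uniserial exactly when any two of its elements are comparable, one being a
    multiple of the other, and [N] has only finitely many submodules
    ([uniserialP]).  In this form uniseriality visibly passes to submodules and
    to quotients.  That a unique composition series lists all submodules
    follows by refinement: intersecting a series with a submodule [X], and
    adding [X] to it, yields a series through [X], which is then the unique one.
    Conversely, finiteness provides a composition series, and in a chain of
    submodules each term of a series is determined by the preceding one.

    Suppose now that [M] is the direct sum of two nonzero modules [V] and [W].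
    The two projections restricted to [U1] have kernels with zero intersection,
    so, the submodules of [U1] being nested, one projection is injective on
    [U1], say the one to [V].  Then [W] meets [U1] trivially, so [W] embeds in
    [U2] and is uniserial.  Let [e] be the projection from [U1] to [V], and [k]
    the map from [V] to [U2], whose kernel [K], the intersection of [V] and
    [U1], lies in the image of [e].
    - If the image of [e] is not contained in [K], then every submodule of [V]
      is comparable with [K]; those below [K] form a finite chain because [U1]
      is uniserial, those above because [V / K] embeds in [U2]
      ([uniserial_overlap]).
    - If the image of [e] is contained in [K], then [U1] lies in [V], so [U2] is
      the direct sum of [V / U1] and [W]; the elements of [U2] being pairwise
      comparable and [W] being nonzero, [V] equals [U1]. *)

Set Implicit Arguments.
Unset Strict Implicit.
Unset Printing Implicit Defensive.

Import GRing.Theory.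
Local Open Scope ring_scope.

(** * Operations on submodules *)

Section SubmoduleOperations.
Variable R : pzRingType.
Implicit Types M N : lmodType R.

Lemma submodB M (A : submodClosed M) x y : x \in A -> y \in A -> x - y \in A.
Proof. by move=> Ax Ay; rewrite rpredD // -scaleN1r rpredZ. Qed.

Definition submod_of_set M (S : M -> Prop) (S0 : S 0)
    (SL : forall (a : R) x y, S x -> S y -> S (a *: x + y)) : submodClosed M :=
  sval (boolp.cid (submodClosed_of_set S0 SL)).

Lemma mem_submod_of_set M (S : M -> Prop) S0 SL x :
  x \in @submod_of_set M S S0 SL <-> S x.
Proof. exact: (svalP (boolp.cid (submodClosed_of_set S0 SL))). Qed.

Definition submod_image M N (h : {linear M -> N}) (A : submodClosed M) :
  submodClosed N.
Proof.
apply: (@submod_of_set N (fun y => exists2 x, x \in A & y = h x)).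
  by exists 0; rewrite ?rpred0 ?raddf0.
move=> a _ _ [x Ax ->] [y Ay ->]; exists (a *: x + y); last by rewrite linearP.
by rewrite rpredD ?rpredZ.
Defined.

Lemma submod_imageP M N (h : {linear M -> N}) A y :
  y \in submod_image h A <-> exists2 x, x \in A & y = h x.
Proof. exact: mem_submod_of_set. Qed.

Definition submod_preimage M N (h : {linear M -> N}) (B : submodClosed N) :
  submodClosed M.
Proof.
apply: (@submod_of_set M (fun x => h x \in B)); first by rewrite raddf0 rpred0.
by move=> a x y Bx By; rewrite linearP rpredD ?rpredZ.
Defined.

Lemma submod_preimageP M N (h : {linear M -> N}) B x :
  x \in submod_preimage h B <-> h x \in B.
Proof. exact: (mem_submod_of_set (S := fun x => h x \in B)). Qed.

Definition submod_meet M (A B : submodClosed M) : submodClosed M.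
Proof.
apply: (@submod_of_set M (fun x => x \in A /\ x \in B)).
  by rewrite !rpred0.
by move=> a x y [Ax Bx] [Ay By]; rewrite !rpredD ?rpredZ.
Defined.

Lemma submod_meetP M (A B : submodClosed M) x :
  x \in submod_meet A B <-> x \in A /\ x \in B.
Proof. exact: (mem_submod_of_set (S := fun x => x \in A /\ x \in B)). Qed.

Definition submod_sum M (A B : submodClosed M) : submodClosed M.
Proof.
apply: (@submod_of_set M (fun z => exists x y, [/\ x \in A, y \in B & z = x + y])).
  by exists 0, 0; rewrite !rpred0 addr0.
move=> a _ _ [x1 [y1 [Ax1 By1 ->]]] [x2 [y2 [Ax2 By2 ->]]].
exists (a *: x1 + x2), (a *: y1 + y2); rewrite !rpredD ?rpredZ //; split=> //.
by rewrite scalerDr addrACA.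
Defined.

Lemma submod_sumP M (A B : submodClosed M) z :
  z \in submod_sum A B <-> exists x y, [/\ x \in A, y \in B & z = x + y].
Proof. exact: mem_submod_of_set. Qed.

Definition submod_cyclic M (x : M) : submodClosed M.
Proof.
apply: (@submod_of_set M (fun y => exists a : R, y = a *: x)).
  by exists 0; rewrite scale0r.
by move=> a _ _ [b ->] [c ->]; exists (a * b + c); rewrite scalerDl scalerA.
Defined.

Lemma submod_cyclicP M (x y : M) :
  y \in submod_cyclic x <-> exists a : R, y = a *: x.
Proof. exact: mem_submod_of_set. Qed.

Lemma mem_submod_cyclic M (x : M) : x \in submod_cyclic x.
Proof. by apply/submod_cyclicP; exists 1; rewrite scale1r. Qed.

Definition submod_zero M : submodClosed M.
Proof.
apply: (@submod_of_set M (fun x => x = 0)) => //.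
by move=> a x y -> ->; rewrite scaler0 addr0.
Defined.

Lemma submod_zeroP M (x : M) : x \in submod_zero M <-> x = 0.
Proof. exact: mem_submod_of_set. Qed.

Definition submod_full M : submodClosed M.
Proof. exact: (@submod_of_set M (fun=> True)). Defined.

Lemma mem_submod_full M (x : M) : x \in submod_full M.
Proof. exact/(mem_submod_of_set (S := fun=> True)). Qed.

Lemma submod_eq M (A B : submodClosed M) :
  {subset A <= B} -> {subset B <= A} -> A = B.
Proof. by move=> AB BA; apply: submodClosed_ext => x; apply/idP/idP => [/AB|/BA]. Qed.

Lemma subset_or_witness M (A B : submodClosed M) :
  {subset A <= B} \/ exists2 x, x \in A & x \notin B.
Proof.
case: (boolp.pselect (exists2 x, x \in A & x \notin B)) => [|nex]; first by right.
by left=> x Ax; apply: boolp.contrapT => /negP Bx; apply: nex; exists x.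
Qed.

Lemma submod_full_eq M (A : submodClosed M) : A =i predT -> A = submod_full M.
Proof. by move=> AT; apply: submodClosed_ext => x; rewrite AT mem_submod_full. Qed.

Lemma submod_zero_eq M (A : submodClosed M) : A =i pred1 0 -> A = submod_zero M.
Proof.
move=> A0; apply: submodClosed_ext => x; rewrite A0 inE.
by apply/eqP/idP => /submod_zeroP.
Qed.

End SubmoduleOperations.

(** * Composition series as chains of covers *)

Section Covers.
Variables (R : pzRingType) (M : lmodType R).
Implicit Types A B C X : submodClosed M.

Definition covers A B : Prop :=
  [/\ {subset A <= B}, exists2 x, x \in B & x \notin A
    & forall C, {subset A <= C} -> {subset C <= B} -> C = A \/ C = B].

(** The correspondence theorem: the submodules of [B / A] are those between [A]
    and [B]. *)
Lemma simple_factorE A B :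
  {subset A <= B} -> simple_module (factor A B) <-> covers A B.
Proof.
pose pi : {linear submod_type B -> factor A B} := quotmod_proj _.
pose incl : {linear submod_type B -> M} := val.
have pi_onto q : exists u, pi u = q by exists (repr q); apply: quotmod_reprK.
have pi_eq u v : pi u = pi v <-> incl u - incl v \in A.
  have := quotmod_projE (submod_trace_pred A (B:=B)) u v.
  rewrite inE raddfB => <-; split => [E|/eqP//]; exact/eqP.
have pi0 u : pi u = 0 <-> incl u \in A.
  by have := pi_eq u 0; rewrite (raddf0 pi) (raddf0 incl) subr0.
move=> AB; split=> [[nz simp]|[_ [x Bx Ax] max]].
  split=> //.
    apply: boolp.contrapT => noX; apply: nz => q; have [u <-] := pi_onto q.
    apply/pi0; case E: (incl u \in A) => //; case: noX; exists (incl u).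
      by case: u E.
    by rewrite E.
  move=> C leAC CB.
  have [D0|DT] := simp (submod_image pi (submod_preimage incl C)).
    left; apply: submod_eq => // x Cx; pose u := SubmodElt (CB _ Cx).
    have /eqP/pi0 // : pi u == 0.
    have := D0 (pi u); rewrite inE => <-; apply/submod_imageP; exists u => //.
    exact/submod_preimageP.
  right; apply: submod_eq => // x Bx; pose u := SubmodElt Bx.
  have := DT (pi u); rewrite inE => /submod_imageP [v /submod_preimageP Cv].
  move/pi_eq/leAC => Cuv.
  by rewrite -[x](subrK (incl v)) rpredD.
split=> [/(_ (pi (SubmodElt Bx)))/pi0|D]; first by apply/negP.
have [| |CA|CB] := max (submod_image incl (submod_preimage pi D)).
- move=> y Ay; apply/submod_imageP; exists (SubmodElt (AB _ Ay)) => //.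
  by apply/submod_preimageP; rewrite (_ : pi _ = 0) ?rpred0 //; apply/pi0.
- by move=> _ /submod_imageP [[y By] _ ->].
- left=> q; rewrite inE; apply/idP/eqP => [Dq|->]; last exact: rpred0.
  have [u Eq] := pi_onto q; rewrite -Eq in Dq *; apply/pi0; rewrite -CA.
  by apply/submod_imageP; exists u => //; apply/submod_preimageP.
right=> q; rewrite inE; have [u <-] := pi_onto q.
have Bu : incl u \in B by case: u.
have /submod_imageP : incl u \in submod_image incl (submod_preimage pi D).
  by rewrite CB.
case=> v /submod_preimageP Dv /val_inj ->; exact: Dv.
Qed.

Definition reachable A B : Prop :=
  exists s : seq (submodClosed M), simple_factors A s /\ last A s = B.

Lemma reachable_refl A : reachable A A.
Proof. by exists [::]. Qed.

Lemma covers_reachable A B : covers A B -> reachable A B.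
Proof.
move=> AB; have [sAB _ _] := AB; exists [:: B]; split=> //=; split=> //.
exact/simple_factorE.
Qed.

Lemma simple_factors_cat A s t :
  simple_factors A (s ++ t) <-> simple_factors A s /\ simple_factors (last A s) t.
Proof.
elim: s A => [|B s IHs] A /=; first by split=> // [] [].
by split=> [[? ? /IHs []]|[[? ? ?] ?]] //; split=> //; apply/IHs.
Qed.

Lemma reachable_trans A B C : reachable A B -> reachable B C -> reachable A C.
Proof.
move=> [s [As <-]] [t [Bt <-]]; exists (s ++ t).
by rewrite simple_factors_cat last_cat.
Qed.

(** An operation which sends covers to covers or equalities
    sends composition series to composition series with repetitions. *)
Lemma reachable_map (F : submodClosed M -> submodClosed M) :
    (forall A B, covers A B -> F A = F B \/ covers (F A) (F B)) ->
  forall A B, reachable A B -> reachable (F A) (F B).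
Proof.
move=> Fc A _ [s [sA <-]]; elim: s A sA => [|B s IHs] A /=.
  by move=> _; apply: reachable_refl.
case=> AB /(simple_factorE AB)/Fc FAB /IHs; case: FAB => [-> //|].
by move/covers_reachable/reachable_trans; apply.
Qed.

Lemma covers_meet X A B :
  covers A B -> submod_meet A X = submod_meet B X \/
    covers (submod_meet A X) (submod_meet B X).
Proof.
move=> [AB _ max]; set AX := submod_meet A X; set BX := submod_meet B X.
have sAX : {subset AX <= BX}.
  by move=> x /submod_meetP [/AB Bx Xx]; apply/submod_meetP.
have [sBX|ex] := subset_or_witness BX AX.
  by left; apply: submod_eq.
right; split=> // C leAC CB.
have [| |CA|CBe] := max (submod_sum A C).
- by move=> x Ax; apply/submod_sumP; exists x, 0; rewrite rpred0 addr0.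
- move=> _ /submod_sumP [x [y [/AB Bx /CB/submod_meetP [By _] ->]]].
  exact: rpredD.
- left; apply: submod_eq => // x Cx; have /CB/submod_meetP [_ Xx] := Cx.
  apply/submod_meetP; split=> //; rewrite -CA; apply/submod_sumP.
  by exists 0, x; rewrite rpred0 add0r.
right; apply: submod_eq => // z /submod_meetP []; rewrite -CBe.
(* The modular law: C lies in X, so if x + y is in X, then so is x. *)
move=> /submod_sumP [x [y [Ax Cy ->]]] Xxy; apply: rpredD => //; apply: leAC.
have /CB/submod_meetP [_ Xy] := Cy.
apply/submod_meetP; split=> //.
by rewrite -[x](addrK y); apply: submodB.
Qed.

Lemma covers_sum X A B :
  covers A B -> submod_sum A X = submod_sum B X \/
    covers (submod_sum A X) (submod_sum B X).
Proof.
move=> [AB _ max]; set AX := submod_sum A X; set BX := submod_sum B X.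
have sAX : {subset AX <= BX}.
  move=> _ /submod_sumP [x [y [/AB Bx Xy ->]]]; apply/submod_sumP.
  by exists x, y.
have [sBX|ex] := subset_or_witness BX AX.
  by left; apply: submod_eq.
right; split=> // C leAC CB.
have XC y : y \in X -> y \in C.
  by move=> Xy; apply/leAC/submod_sumP; exists 0, y; rewrite rpred0 add0r.
have [| |CA|CBe] := max (submod_meet B C).
- move=> x Ax; apply/submod_meetP; split; first exact: AB.
  by apply/leAC/submod_sumP; exists x, 0; rewrite rpred0 addr0.
- by move=> x /submod_meetP [].
- left; apply: submod_eq => // z Cz.
  have /CB/submod_sumP [x [y [Bx Xy Ez]]] := Cz.
  apply/submod_sumP; exists x, y; split=> //; rewrite -CA.
  apply/submod_meetP; split=> //.
  by rewrite -[x](addrK y) -Ez submodB // XC.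
right; apply: submod_eq => // _ /submod_sumP [x [y [Bx Xy ->]]].
apply: rpredD; last exact: XC.
rewrite -CBe in Bx.
by have /submod_meetP [] := Bx.
Qed.

(** A composition series can be refined through [X], by intersecting it with
    [X] and adding [X] to it. *)
Lemma reachable_through X :
    reachable (submod_zero M) (submod_full M) ->
  reachable (submod_zero M) X /\ reachable X (submod_full M).
Proof.
move=> M0; split.
  have := reachable_map (covers_meet X) M0.
  rewrite (_ : submod_meet _ X = submod_zero M); last first.
    apply: submod_eq => x /=; first by case/submod_meetP.
    by move=> /submod_zeroP ->; rewrite rpred0.
  rewrite (_ : submod_meet _ X = X) //.
  apply: submod_eq => x; first by case/submod_meetP.
  by move=> Xx; apply/submod_meetP; rewrite mem_submod_full.
have := reachable_map (covers_sum X) M0.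
rewrite (_ : submod_sum _ X = X); last first.
  apply: submod_eq => [_ /submod_sumP [x [y [/submod_zeroP -> Xy ->]]]|x Xx].
    by rewrite add0r.
  by apply/submod_sumP; exists 0, x; rewrite rpred0 add0r.
rewrite (_ : submod_sum _ X = submod_full M) //.
apply: submod_eq => x _; first exact: mem_submod_full.
by apply/submod_sumP; exists x, 0; rewrite mem_submod_full rpred0 addr0.
Qed.

(** Each listed submodule lying strictly between [A] and [B] splits the interval
    into two smaller ones; an interval with nothing strictly inside is a cover. *)
Lemma finite_interval_reachable (L : seq (submodClosed M)) A B :
    {subset A <= B} ->
    (forall C, {subset A <= C} -> {subset C <= B} ->
      [\/ C = A, C = B | List.In C L]) ->
  reachable A B.
Proof.
elim: L A B => [|D L IHL] A B AB inL.
  have [BA|ex] := subset_or_witness B A.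
    by rewrite (submod_eq AB BA); apply: reachable_refl.
  apply: covers_reachable; split=> // C leAC CB.
  by case: (inL C leAC CB); [left | right | ].
case: (boolp.pselect ({subset A <= D} /\ {subset D <= B})) => [[AD DB]|nD].
  apply: (@reachable_trans _ D); apply: IHL => // C.
    move=> leAC CD; case: (inL C leAC) => [x /CD/DB //|->|EC|/= [<-|]].
    - exact: Or31.
    - by apply: Or32; apply: submod_eq CD _; rewrite EC.
    - exact: Or32.
    - exact: Or33.
  move=> DC CB; case: (inL C _ CB) => [x /AD/DC //|EC|->|/= [<-|]].
  - by apply: Or31; apply: submod_eq DC; rewrite EC.
  - exact: Or32.
  - exact: Or31.
  - exact: Or33.
apply: IHL => // C leAC CB; case: (inL C leAC CB) => [||[DC|]].
- exact: Or31.
- exact: Or32.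
- by case: nD; rewrite DC.
- exact: Or33.
Qed.

Lemma composition_series_reachable s :
    composition_series s ->
  exists s', [/\ s = submod_zero M :: s', simple_factors (submod_zero M) s'
                & last (submod_zero M) s' = submod_full M].
Proof.
case: s => //= A s [/submod_zero_eq -> sA /submod_full_eq lA].
by exists s.
Qed.

Lemma reachable_composition_series s :
    simple_factors (submod_zero M) s ->
    last (submod_zero M) s = submod_full M ->
  composition_series (submod_zero M :: s).
Proof.
move=> sA lA; split=> // x; last by rewrite lA mem_submod_full.
by rewrite inE; apply/idP/eqP => /submod_zeroP.
Qed.

Lemma in_last A s : List.In (last A s) (A :: s).
Proof. by elim: s A => [|B s IHs] A /=; [left | right; apply: IHs]. Qed.

Lemma simple_factors_chain A s B C :
    simple_factors A s -> List.In B (A :: s) -> List.In C (A :: s) ->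
  {subset B <= C} \/ {subset C <= B}.
Proof.
have low (D : submodClosed M) t E : simple_factors D t -> List.In E (D :: t) -> {subset D <= E}.
  elim: t D => [|F t IHt] D /=; first by move=> _ [<-|].
  by case=> DF _ /IHt Ft [<-|/Ft FE] // x /DF/FE.
elim: s A => [|D s IHs] A sA; first by case=> // <- [] // <-; left.
have lowA E := low _ _ E sA; case: (sA) => _ _ /IHs sD.
case=> [<- /lowA|BD]; first by left.
case=> [<-|CD]; first by right; apply: lowA; right.
exact: sD.
Qed.

End Covers.

(** * Uniserial modules through their elements *)

Section Uniserial.
Variable R : pzRingType.
Implicit Types M N : lmodType R.

Definition comparable_elements M : Prop :=
  forall x y : M, (exists a : R, x = a *: y) \/ (exists a : R, y = a *: x).

Definition finitely_many_submodules M : Prop :=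
  exists L : seq (submodClosed M), forall A, List.In A L.

Lemma comparable_submodules M (A B : submodClosed M) :
  comparable_elements M -> {subset A <= B} \/ {subset B <= A}.
Proof.
move=> cM; have [AB|[x Ax Bx]] := subset_or_witness A B; first by left.
right=> y By; case: (cM x y) => [] [a E]; last by rewrite E rpredZ.
by case/negP: Bx; rewrite E rpredZ.
Qed.

(** Two series cannot part: their next terms would be comparable covers of the
    same submodule, hence equal. *)
Lemma simple_factors_unique M (A : submodClosed M) s t :
    comparable_elements M -> simple_factors A s -> simple_factors A t ->
    last A s = submod_full M -> last A t = submod_full M -> s = t.
Proof.
move=> cM; have maxT B u : simple_factors (submod_full M) (B :: u) -> False.
  case=> TB /(simple_factorE TB) [_ [x _]]; by rewrite mem_submod_full.
elim: s A t => [|B s IHs] A [|C t] //.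
- by move=> _ sA /= EA; rewrite EA in sA; case: (maxT _ _ sA).
- by move=> sA _ _ /= EA; rewrite EA in sA; case: (maxT _ _ sA).
move=> [AB /(simple_factorE AB) cAB sB] [leAC /(simple_factorE leAC) cAC tC] lB lC.
have nested D E : covers A D -> covers A E -> {subset D <= E} -> D = E.
  move=> [AD [x Dx Ax] _] [_ _ max] DE; case: (max D AD DE) => // ED.
  by rewrite -ED Dx in Ax.
have EBC : B = C.
  case: (comparable_submodules B C cM) => [|CB]; first exact: nested.
  by symmetry; apply: nested.
by rewrite -EBC in tC lC *; rewrite (IHs B t).
Qed.

Lemma uniserialP M :
  uniserial M <-> comparable_elements M /\ finitely_many_submodules M.
Proof.
split=> [[s0 [/composition_series_reachable [s [-> s0s ls] us]]]|[cM [L inL]]].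
  have all_s A : List.In A (submod_zero M :: s).
    have M0 : reachable (submod_zero M) (submod_full M) by exists s.
    have [[s1 [s1A l1]] [s2 [s2A l2]]] := reachable_through A M0.
    rewrite (us ((submod_zero M :: s1) ++ s2)); last first.
      apply: reachable_composition_series; last by rewrite last_cat l1.
      by apply/simple_factors_cat; rewrite l1.
    apply: (List.in_or_app (submod_zero M :: s1) s2 A); left.
    by rewrite -l1; apply: in_last.
  split; last by exists (submod_zero M :: s).
  move=> x y.
  have [xy|yx] := simple_factors_chain s0s (all_s (submod_cyclic x))
                    (all_s (submod_cyclic y)).
    by left; apply/submod_cyclicP/xy/mem_submod_cyclic.
  by right; apply/submod_cyclicP/yx/mem_submod_cyclic.
have [||s [s0 ls]] := @finite_interval_reachable _ _ L (submod_zero M) (submod_full M).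
- by move=> x _; apply: mem_submod_full.
- by move=> C _ _; apply: Or33.
exists (submod_zero M :: s); split; first exact: reachable_composition_series.
move=> _ /composition_series_reachable [t [-> t0 lt]].
by rewrite (simple_factors_unique cM s0 t0 ls lt).
Qed.

Lemma zero_module_uniserial M : zero_module M -> uniserial M.
Proof.
move=> M0; apply/uniserialP; split.
  by move=> x y; left; exists 0; rewrite scale0r.
exists [:: submod_zero M] => A; left.
by apply: submod_eq => x _; rewrite (M0 x) rpred0.
Qed.

Lemma uniserial_sub M N (h : {linear M -> N}) :
  (forall x, h x = 0 -> x = 0) -> uniserial N -> uniserial M.
Proof.
move=> h0 /uniserialP [cN [L inL]].
have hI : injective h.
  by move=> x y E; apply/subr0_eq/h0; rewrite linearB /= E subrr.
apply/uniserialP; split.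
  move=> x y; case: (cN (h x) (h y)) => [] [a E]; [left | right]; exists a.
    by apply: hI; rewrite linearZ.
  by apply: hI; rewrite linearZ.
exists (map (submod_preimage h) L) => A.
rewrite (_ : A = submod_preimage h (submod_image h A)); first exact: List.in_map.
apply: submod_eq => x.
  by move=> Ax; apply/submod_preimageP/submod_imageP; exists x.
by move=> /submod_preimageP/submod_imageP [y Ay /hI ->].
Qed.

Lemma uniserial_quotient M N (h : {linear M -> N}) :
  (forall y, exists x, y = h x) -> uniserial M -> uniserial N.
Proof.
move=> hS /uniserialP [cM [L inL]]; apply/uniserialP; split.
  move=> y1 y2; have [x1 ->] := hS y1; have [x2 ->] := hS y2.
  by case: (cM x1 x2) => [] [a ->]; [left | right]; exists a; rewrite linearZ.
exists (map (submod_image h) L) => B.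
rewrite (_ : B = submod_image h (submod_preimage h B)); first exact: List.in_map.
apply: submod_eq => [y By|_ /submod_imageP [x /submod_preimageP Bx ->]] //.
have [x Ey] := hS y; apply/submod_imageP; exists x => //.
by apply/submod_preimageP; rewrite -Ey.
Qed.

(** Gluing two uniserial pieces which overlap: the image of [e] and [V]
    modulo the kernel [K] of [k].  An element [x] outside [K] has a multiple in
    the image of [e] but outside [K], because [k x] is comparable with
    [k (e u0)]; inside the image of [e] that multiple generates all of [K].  So
    every submodule either lies in [K] or contains [K]. *)
Lemma uniserial_overlap (U V U' : lmodType R) (e : {linear U -> V})
    (k : {linear V -> U'}) (u0 : U) :
    uniserial U -> uniserial U' ->
    (forall x, k x = 0 -> exists u, x = e u) -> k (e u0) <> 0 ->
  uniserial V.
Proof.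
move=> /uniserialP [cU [L inL]] /uniserialP [cU' [L' inL']] Ke ku0.
have K_im u z : k (e u) <> 0 -> k z = 0 -> exists a, z = a *: e u.
  move=> ku kz; have [t Ez] := Ke z kz; case: (cU t u) => [] [a E].
    by exists a; rewrite Ez E linearZ.
  by case: ku; rewrite E !linearZ /= -Ez kz scaler0.
have K_gen x z : k x <> 0 -> k z = 0 -> exists a, z = a *: x.
  move=> kx kz; case: (cU' (k x) (k (e u0))) => [] [a E].
    have [|t Et] := Ke (x - a *: e u0).
      by rewrite linearB linearZ /= E subrr.
    have Ex : x = e (a *: u0 + t) by rewrite linearD linearZ /= -Et addrC subrK.
    by rewrite Ex in kx *; apply: K_im.
  have [|t Et] := Ke (e u0 - a *: x).
    by rewrite linearB linearZ /= E subrr.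
  have Eax : a *: x = e (u0 - t) by rewrite linearB -Et opprB addrC subrK.
  have [|b ->] := K_im (u0 - t) z _ kz.
    by rewrite -Eax linearZ /= -E.
  by exists (b * a); rewrite -Eax scalerA.
have cmp x y : k y <> 0 -> (exists a, k x = a *: k y) -> exists a, x = a *: y.
  move=> ky [a E]; have [|b Eb] := K_gen y (x - a *: y) ky.
    by rewrite linearB linearZ /= E subrr.
  by exists (b + a); rewrite scalerDl -Eb subrK.
apply/uniserialP; split.
  move=> x y; case: (boolp.pselect (k x = 0)) => [kx|kx]; last first.
    case: (boolp.pselect (k y = 0)) => [ky|ky]; first by right; apply: K_gen.
    by case: (cU' (k x) (k y)) => ?; [left | right]; apply: cmp.
  case: (boolp.pselect (k y = 0)) => [ky|ky]; last by left; apply: K_gen.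
  have [[u ->] [v ->]] := (Ke x kx, Ke y ky).
  by case: (cU u v) => [] [a ->]; [left | right]; exists a; rewrite linearZ.
exists (map (submod_image e) L ++ map (submod_preimage k) L')%list => A.
apply/List.in_or_app.
case: (boolp.pselect (exists2 x, x \in A & k x <> 0)) => [[x Ax kx]|nex].
  right; rewrite (_ : A = submod_preimage k (submod_image k A)).
    exact: List.in_map.
  apply: submod_eq => y.
    by move=> Ay; apply/submod_preimageP/submod_imageP; exists y.
  move=> /submod_preimageP/submod_imageP [z Az E].
  have [|a Ea] := K_gen x (y - z) kx; first by rewrite linearB /= E subrr.
  by rewrite -[y](subrK z) Ea rpredD ?rpredZ.
left; rewrite (_ : A = submod_image e (submod_preimage e A)).
  exact: List.in_map.
apply: submod_eq => [y Ay|_ /submod_imageP [u /submod_preimageP Au ->]] //.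
have [|u Eu] := Ke y; first by apply: boolp.contrapT => ky; apply: nex; exists y.
by apply/submod_imageP; exists u => //; apply/submod_preimageP; rewrite -Eu.
Qed.

End Uniserial.

(** * Decompositions of an extension of uniserial modules *)

Section Decomposition.
Variable R : pzRingType.
Implicit Types M V W : lmodType R.

(** A direct sum decomposition given by its injections and projections, a form
    in which the two summands can be exchanged. *)
Definition biproduct M V W (i : {linear V -> M}) (j : {linear W -> M})
    (p : {linear M -> V}) (q : {linear M -> W}) : Prop :=
  [/\ cancel i p, cancel j q, forall w, p (j w) = 0, forall v, q (i v) = 0
    & forall m, m = i (p m) + j (q m)].

Lemma biproduct_sym M V W (i : {linear V -> M}) (j : {linear W -> M}) p q :
  biproduct i j p q -> biproduct j i q p.
Proof. by case=> ip jq pj qi E; split=> // m; rewrite addrC -E. Qed.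

Lemma is_direct_sum_biproduct M V W :
  is_direct_sum M V W -> exists i j p q, @biproduct M V W i j p q.
Proof.
case=> h [h' hK h'K].
have lh' : linear h' by exact: (can2_linear hK h'K).
pose iV v : M := h (v, 0); pose iW w : M := h (0, w).
pose pV m := (h' m).1; pose pW m := (h' m).2.
have li : linear iV.
  by move=> a x y; rewrite /iV -linearP; congr (h (_, _)); rewrite /= scaler0 addr0.
have lj : linear iW.
  by move=> a x y; rewrite /iW -linearP; congr (h (_, _)); rewrite /= scaler0 addr0.
have lp : linear pV by move=> a x y; rewrite /pV lh'.
have lq : linear pW by move=> a x y; rewrite /pW lh'.
pose i : {linear V -> M} := HB.pack iV (GRing.isLinear.Build R V M *:%R iV li).
pose j : {linear W -> M} := HB.pack iW (GRing.isLinear.Build R W M *:%R iW lj).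
pose p : {linear M -> V} := HB.pack pV (GRing.isLinear.Build R M V *:%R pV lp).
pose q : {linear M -> W} := HB.pack pW (GRing.isLinear.Build R M W *:%R pW lq).
exists i, j, p, q; split=> [v|w|w|v|m] /=; rewrite /pV /pW /iV /iW ?hK //.
rewrite -linearD -[LHS]h'K; congr (h _); case: (h' m) => x y.
by congr (_, _); rewrite /= ?addr0 ?add0r.
Qed.

Lemma uniserial_summands (U1 M U2 V W : lmodType R)
    (f : {linear U1 -> M}) (g : {linear M -> U2}) (i : {linear V -> M})
    (j : {linear W -> M}) (p : {linear M -> V}) (q : {linear M -> W}) :
    short_exact f g -> uniserial U1 -> uniserial U2 -> biproduct i j p q ->
    ~ zero_module W -> (forall u, p (f u) = 0 -> u = 0) ->
  uniserial V /\ uniserial W.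
Proof.
move=> [fI ker_g _] uU1 uU2 [ip jq pj qi dec] W0 pf0.
have gf u : g (f u) = 0 by apply/ker_g; exists u.
have gj0 w : g (j w) = 0 -> w = 0.
  case/ker_g => u Eu; rewrite -(jq w) -Eu (pf0 u) ?linear0 //.
  by rewrite Eu.
split; last exact: (@uniserial_sub _ _ _ (g \o j)) uU2.
have [w0 w0N] : exists w0 : W, w0 <> 0.
  apply: boolp.contrapT => nex; apply: W0 => w; apply: boolp.contrapT => wN.
  by apply: nex; exists w.
case: (boolp.pselect (exists u, g (i (p (f u))) <> 0)) => [[u0 ku0]|nex].
  apply: (@uniserial_overlap _ _ _ _ (p \o f) (g \o i) u0) => // v /ker_g [u Eu].
  by exists u; rewrite /= Eu ip.
have qf u : q (f u) = 0.
  apply: gj0; apply: boolp.contrapT => gjN; apply: nex; exists u => gi0.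
  by apply: gjN; have := gf u; rewrite [f u]dec linearD gi0 add0r -dec.
apply: (@uniserial_quotient _ _ _ (p \o f)) => // v.
have /uniserialP [cU2 _] := uU2.
case: (cU2 (g (i v)) (g (j w0))) => [] [a E].
  have /ker_g [u Eu] : g (i v - j (a *: w0)) = 0.
    by rewrite linearB /= E (linearZ_LR j) (linearZ_LR g) subrr.
  by exists u; rewrite /= Eu linearB ip pj subr0.
have /ker_g [u Eu] : g (j w0 - i (a *: v)) = 0.
  by rewrite linearB /= E (linearZ_LR i) (linearZ_LR g) subrr.
by case: w0N; have := qf u; rewrite Eu linearB jq qi subr0.
Qed.

(** The kernels of the two maps meet trivially, and comparability makes one of
    them contain the other. *)
Lemma injective_component (U V W : lmodType R) (e1 : {linear U -> V})
    (e2 : {linear U -> W}) :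
    comparable_elements U -> (forall u, e1 u = 0 -> e2 u = 0 -> u = 0) ->
  (forall u, e1 u = 0 -> u = 0) \/ (forall u, e2 u = 0 -> u = 0).
Proof.
move=> cU e0; case: (boolp.pselect (forall u, e1 u = 0 -> u = 0)) => [|n1].
  by left.
right=> v e2v; apply: boolp.contrapT => vN; apply: n1 => u e1u.
case: (cU u v) => [] [a E]; first by apply: e0; rewrite // E linearZ /= e2v scaler0.
by case: vN; apply: e0; rewrite // E linearZ /= e1u scaler0.
Qed.

End Decomposition.

Theorem proposition6p1 (R : pzRingType) (hR : left_artinian R)
    (U1 M U2 : lmodType R)
    (fgU1 : finitely_generated U1) (fgM : finitely_generated M)
    (fgU2 : finitely_generated U2)
    (f : {linear U1 -> M}) (g : {linear M -> U2}) (exact_fg : short_exact f g)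
    (uniU1 : uniserial U1) (uniU2 : uniserial U2) :
  indecomposable M \/
  exists V1 V2 : lmodType R,
    [/\ uniserial V1, uniserial V2 & is_direct_sum M V1 V2].
Proof.
case: (boolp.pselect (indecomposable M)) => [|decM]; [by left | right].
case: (boolp.pselect (zero_module M)) => [M0|MN].
  exists M, M; split; try exact: zero_module_uniserial.
  exists fst; exists (fun x => (x, x)) => [[x y]|x] //=.
  by rewrite (M0 x) (M0 y).
have [V [W [sumM VN WN]]] : exists V W,
    [/\ is_direct_sum M V W, ~ zero_module V & ~ zero_module W].
  apply: boolp.contrapT => nex; apply: decM; split=> // V W sumM.
  apply: boolp.contrapT => nz; apply: nex; exists V, W.
  by split=> // Z; apply: nz; [left | right].
exists V, W.
have [i [j [p [q bi]]]] := is_direct_sum_biproduct sumM.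
have /uniserialP [cU1 _] := uniU1.
have [u pu qu|pf|qf] := @injective_component _ _ _ _ (p \o f) (q \o f) cU1.
- have [fI _ _] := exact_fg; have [_ _ _ _ dec] := bi.
  by apply: fI; rewrite linear0 [f u]dec [p _]pu [q _]qu !linear0 addr0.
- by have [] := uniserial_summands exact_fg uniU1 uniU2 bi WN pf.
by have [] := uniserial_summands exact_fg uniU1 uniU2 (biproduct_sym bi) VN qf.
Qed.
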